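(* Let $(c_n),(d_n)$ be sequences of non-negative reals with $c_n=o(\log n)$, $d_n=o(\log n)$, and suppose the edge probabilities are $p_n=c_nn^{-1}\in[0,1]$ and $q_n=d_nn^{-1}\in[0,1]$ (Kesten-Stigum phase). For every $n\ge1$ let $\theta_n\in\Theta_n$, $X^n\sim P_{\theta_n}$, and choose the uniform prior on $\Theta_n$. Let $0<a<1/2$ be given. If there is a constant $C>1$ such that for all large enough $n$, $$\bigl(\sqrt{c_n}-\sqrt{d_n}\bigr)^2>4C\bigl(1-\log(a)\bigr),$$ then the posterior recovers the true community assignment almost exactly with error rate $k_n=an$, i.e. $P_{\theta_n}\Pi(B_n(\theta_n,an)\mid X^n)\to1$ as $n\to\infty$.
   Context: Stochastic block model with two communities: for $n\ge1$ and $0\le m\le\lfloor n/2\rfloor$ let $\Theta_{n,m}=\{\theta_n\in\{0,1\}^n:\sum_i\theta_{n,i}=m\}$, except that for even $n$ and $m=n/2$, $\Theta_{n,n/2}=\{\theta_n\in\{0,1\}^n:\sum_i\theta_{n,i}=n/2,\ \theta_{n,1}=0\}$. Let $\Theta_n=\bigcup_{m=0}^{\lfloor n/2\rfloor}\Theta_{n,m}$; it has $2^{n-1}$ elements. Let $p_n,q_n\in[0,1]$. Under $P_{\theta_n}$ the observed random graph $X^n=\{X_{ij}:1\le i<j\le n\}\in\mathscr{X}_n=\{0,1\}^{\{(i,j):1\le i<j\le n\}}$ has independent edges with $P_{\theta_n}(X_{ij}=1)=Q_{ij}(\theta_n)$, where $Q_{ij}(\theta_n)=p_n$ if $\theta_{n,i}=\theta_{n,j}$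 and $Q_{ij}(\theta_n)=q_n$ if $\theta_{n,i}\ne\theta_{n,j}$. Its probability mass function is $p_{\theta_n}(x^n)=\prod_{i<j}Q_{ij}(\theta_n)^{x_{ij}}(1-Q_{ij}(\theta_n))^{1-x_{ij}}$ (with $0^0=1$). The uniform prior gives mass $2^{-(n-1)}$ to each element of $\Theta_n$; the corresponding posterior is $\Pi(A\mid X^n)=\sum_{\theta\in A}p_{\theta}(X^n)\big/\sum_{\theta'\in\Theta_n}p_{\theta'}(X^n)$ for $A\subset\Theta_n$ (defined whenever the denominator is positive, which holds $P_{\theta_n}$-almost surely for each $\theta_n\in\Theta_n$). $P_{\theta_n}f(X^n)$ denotes the expectation of $f(X^n)$ under $P_{\theta_n}$. For $\theta_n,\eta_n\in\Theta_n$: $h(\theta_n,\eta_n)=\sum_i|\theta_{n,i}-\eta_{n,i}|$, $k(\theta_n,\eta_n)=\min\{h(\theta_n,\eta_n),\,n-h(\theta_n,\eta_n)\}$, and $B_n(\theta_n,r)=\{\eta_n\in\Theta_n:k(\eta_n,\theta_n)\le r\}$ for real $r\ge0$. *)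

(* Defs.v *)
From mathcomp Require Import all_boot all_order all_algebra.

Set Implicit Arguments.
Unset Strict Implicit.
Unset Printing Implicit Defensive.

Import Order.TTheory GRing.Theory Num.Theory.
Local Open Scope ring_scope.

(* Vertices 1, ..., n are encoded as 0, ..., n - 1; labels 0 and 1 as booleans. *)
Definition assignment (n : nat) := {ffun 'I_n -> bool}.

(* When m = n / 2, a partition and its complement both have m ones: the
   condition on the first vertex keeps one of the two. *)
Definition Theta_nm (n m : nat) : {set assignment n} :=
  [set theta : assignment n |
    (\sum_(i < n) (theta i : nat) == m)%N &&
    ((m.*2 == n) ==> [forall i : 'I_n, (i == 0 :> nat) ==> ~~ theta i])].

Definition Theta (n : nat) : {set assignment n} :=
  \bigcup_(m < (n./2).+1) Theta_nm n m.

Definition edge (n : nat) := {e : 'I_n * 'I_n | (e.1 < e.2)%N}.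

Definition graph (n : nat) := {ffun edge n -> bool}.

Section BlockModel.
Variables (R : realFieldType) (n : nat) (p q : R).

Definition edge_prob (theta : assignment n) (e : edge n) : R :=
  if theta (val e).1 == theta (val e).2 then p else q.

Definition sbm_pmf (theta : assignment n) (x : graph n) : R :=
  \prod_(e : edge n)
    (edge_prob theta e ^+ (x e) * (1 - edge_prob theta e) ^+ (1 - x e)).

(* Expectation of f(X) for X distributed according to sbm_pmf theta. *)
Definition sbm_expectation (theta : assignment n) (f : graph n -> R) : R :=
  \sum_(x : graph n) sbm_pmf theta x * f x.

(* Posterior for the uniform prior on Theta n, whose constant mass cancels.
   Where the denominator vanishes the value is 0 by convention; this has
   probability 0 under every element of Theta n. *)
Definition posterior (A : {set assignment n}) (x : graph n) : R :=
  (\sum_(theta in A) sbm_pmf theta x) /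
  (\sum_(theta in Theta n) sbm_pmf theta x).

End BlockModel.

Definition hdist (n : nat) (theta eta : assignment n) : nat :=
  (\sum_(i < n) (theta i != eta i : nat))%N.

Definition kdist (n : nat) (theta eta : assignment n) : nat :=
  minn (hdist theta eta) (n - hdist theta eta).

Definition kball (R : realFieldType) (n : nat) (theta : assignment n) (r : R) :
    {set assignment n} :=
  [set eta in Theta n | (kdist eta theta)%:R <= r].

(* Main.v *)
Require Import Defs.
From mathcomp Require Import all_boot all_order all_algebra.
From mathcomp Require Import all_classical all_reals all_analysis.
From mathcomp Require Import zify ring lra.
Import Order.TTheory GRing.Theory Num.Theory numFieldNormedType.Exports.
Local Open Scope ring_scope.

(** The expected posterior mass outside the ball is the sum, over the
    assignments [eta] outside it, of the expected posterior mass of [eta].  The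
    normalising sum of the posterior dominates both [p_theta x] and [p_eta x],
    hence also their geometric mean, so that
      [p_theta x * (p_eta x / sum) <= sqrt (p_theta x * p_eta x)];
    summing over the graphs [x], the mass of [eta] is at most the Hellinger
    affinity of [P_theta] and [P_eta] ([posterior_miss_le]).

    Affinities are multiplicative over independent edges, and an edge
    contributes the factor 1 unless [theta] and [eta] disagree on whether it
    joins two communities.  This happens when exactly one of its end points is
    relabelled, that is on [h * (n - h)] edges, where [h] is the Hamming
    distance ([sum_sqrt_sbm_pmf], [card_flipped]).  On such an edge the factor is
    [sqrt (p q) + sqrt ((1 - p) (1 - q)) <= exp (- (sqrt p - sqrt q)^2 / 2)].  With
    [k = min (h, n - h)] one has [h (n - h) >= k n / 2], so the separation
    hypothesis bounds the contribution of [eta] by [exp (- C (1 - log a) k)], which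
    is [exp (- ((C - 1) (1 - log a) + 1) k) * a^k].

    It remains to sum over the [eta] with [k > a n].  Instead of counting them by
    binomial coefficients, the first factor is bounded by its value at [k = a n],
    and the second is summed over the whole hypercube, where
    [sum a^k <= 2 (1 + a)^n <= 2 exp (a n)].  The factor [exp (- a n)] coming from
    the [+ 1] in the exponent cancels this entropy, and what is left is
    [2 exp (- (C - 1) (1 - log a) a n)], which tends to 0
    ([sum_affinity_far_le]). *)

(** * Affinity of two Bernoulli laws *)

(** The Hellinger affinity of the Bernoulli laws of parameters [p] and [q]. *)
Definition affinity {R : rcfType} (p q : R) : R :=
  Num.sqrt (p * q) + Num.sqrt ((1 - p) * (1 - q)).

Lemma affinity_ge0 (R : rcfType) (p q : R) : 0 <= affinity p q.
Proof. by rewrite addr_ge0 ?sqrtr_ge0. Qed.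

Lemma affinityC (R : rcfType) (p q : R) : affinity p q = affinity q p.
Proof. by rewrite /affinity mulrC [(1 - p) * _]mulrC. Qed.

Lemma affinityxx (R : rcfType) (p : R) : 0 <= p <= 1 -> affinity p p = 1.
Proof.
move=> /andP[p0 p1]; rewrite /affinity -!expr2 !sqrtr_sqr.
by rewrite !ger0_norm ?subr_ge0// addrC subrK.
Qed.

(** One minus the affinity is half the squared Hellinger distance, whose two
    terms are squares; only the one of the outcome 1 is kept. *)
Lemma affinity_le (R : rcfType) (p q : R) : 0 <= p <= 1 -> 0 <= q <= 1 ->
  affinity p q <= 1 - (Num.sqrt p - Num.sqrt q) ^+ 2 / 2.
Proof.
move=> /andP[p0 p1] /andP[q0 q1].
rewrite /affinity !sqrtrM ?subr_ge0//.
have p'0 : 0 <= 1 - p by lra.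
have q'0 : 0 <= 1 - q by lra.
have := sqr_ge0 (Num.sqrt (1 - p) - Num.sqrt (1 - q)).
rewrite !sqrrB !sqr_sqrtr//; lra.
Qed.

Lemma affinity_le_expR (R : realType) (p q : R) :
  0 <= p <= 1 -> 0 <= q <= 1 ->
  affinity p q <= expR (- ((Num.sqrt p - Num.sqrt q) ^+ 2 / 2)).
Proof.
by move=> p01 q01; apply: le_trans (affinity_le R p q p01 q01) (expR_ge1Dx _).
Qed.

(** * Likelihoods of the block model *)

Lemma edge_prob01 (R : realFieldType) (n : nat) (p q : R)
    (theta : assignment n) (e : edge n) :
  0 <= p <= 1 -> 0 <= q <= 1 -> 0 <= edge_prob p q theta e <= 1.
Proof. by rewrite /edge_prob; case: ifP. Qed.

Lemma bernoulli_ge0 (R : realFieldType) (p : R) (b : bool) : 0 <= p <= 1 ->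
  0 <= p ^+ b * (1 - p) ^+ (1 - b).
Proof. by move=> /andP[p0 p1]; rewrite mulr_ge0 ?exprn_ge0 ?subr_ge0. Qed.

Lemma sbm_pmf_ge0 (R : realFieldType) (n : nat) (p q : R)
    (theta : assignment n) (x : graph n) :
  0 <= p <= 1 -> 0 <= q <= 1 -> 0 <= sbm_pmf p q theta x.
Proof.
by move=> p01 q01; apply: prodr_ge0 => e _; apply/bernoulli_ge0/edge_prob01.
Qed.

Lemma sum_sbm_pmf (R : realFieldType) (n : nat) (p q : R)
    (theta : assignment n) : \sum_(x : graph n) sbm_pmf p q theta x = 1.
Proof.
rewrite -(bigA_distr_bigA (fun (e : edge n) (b : bool) =>
  edge_prob p q theta e ^+ b * (1 - edge_prob p q theta e) ^+ (1 - b))).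
apply: big1 => e _.
by rewrite big_bool /= !(subnn, subn0, expr1, expr0) mulr1 mul1r addrC subrK.
Qed.

(** * Affinity of two block models *)

Lemma sqrtr_prod (R : rcfType) (I : finType) (F : I -> R) :
  (forall i, 0 <= F i) ->
  Num.sqrt (\prod_i F i) = \prod_i Num.sqrt (F i).
Proof.
move=> F0; suff: 0 <= \prod_i F i /\
    Num.sqrt (\prod_i F i) = \prod_i Num.sqrt (F i) by case.
apply: (big_rec2 (fun x y => 0 <= x /\ Num.sqrt x = y)) => [|i x y _ [x0 <-]].
  by rewrite sqrtr1.
by rewrite mulr_ge0// sqrtrM.
Qed.

Lemma hdist_le (n : nat) (theta eta : assignment n) : (hdist theta eta <= n)%N.
Proof.
rewrite -[leqRHS]card_ord -sum1_card.
by apply: leq_sum => i _; case: eqP.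
Qed.

Lemma kdistE (n : nat) (theta eta : assignment n) :
  kdist eta theta = minn (hdist theta eta) (n - hdist theta eta).
Proof. by rewrite /kdist /hdist; under eq_bigr => i _ do rewrite eq_sym. Qed.

(** The edges whose law differs between the two assignments when [p != q]. *)
Definition flipped {n : nat} (theta eta : assignment n) : {set edge n} :=
  [set e : edge n | (theta (val e).1 == theta (val e).2)
                    != (eta (val e).1 == eta (val e).2)].

(** An edge is flipped when exactly one of its end points is relabelled: orienting
    it from the relabelled end point to the other one turns flipped edges into
    pairs (relabelled vertex, other vertex). *)
Lemma card_flipped (n : nat) (theta eta : assignment n) :
  #|flipped theta eta| = (hdist theta eta * (n - hdist theta eta))%N.
Proof.
pose u i := (theta i != eta i : nat).
pose w i := (theta i == eta i : nat).
have -> : (n - hdist theta eta = \sum_(i < n) w i)%N.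
  apply/eqP; rewrite -(eqn_add2l (hdist theta eta)) subnKC ?hdist_le//.
  rewrite -big_split /= -[X in X == _]card_ord -sum1_card.
  by apply/eqP/eq_bigr => i _; rewrite /w; case: eqP.
rewrite big_distrlr /= pair_big /= -sum1_card.
transitivity (\sum_(e : edge n)
    (u (val e).1 * w (val e).2 + w (val e).1 * u (val e).2))%N.
  rewrite big_mkcond /=; apply: eq_bigr => e _; rewrite inE /u /w.
  by case: (theta _); case: (theta _); case: (eta _); case: (eta _).
rewrite -(big_sub _ (fun z => (u z.1 * w z.2 + w z.1 * u z.2)%N)) big_split /=.
rewrite [RHS](bigID (fun z : 'I_n * 'I_n => (z.1 < z.2)%N)) /=.
congr (_ + _)%N.
(* The remaining pairs have z.2 <= z.1: the diagonal contributes 0, and the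
   others are the swapped images of the edges. *)
pose sw (z : 'I_n * 'I_n) := (z.2, z.1).
have swK : involutive sw by case.
rewrite [RHS](bigID (fun z : 'I_n * 'I_n => z.1 == z.2)) /=.
rewrite [X in (X + _)%N]big1 ?add0n; last first.
  by case=> i j /= /andP[_ /eqP->]; rewrite /u /w; case: eqP.
rewrite [RHS](reindex_inj (inv_inj swK)) /=.
apply: eq_big => [[i j]|[i j] _] /=; last by rewrite mulnC.
by rewrite unfold_in /= -leqNgt andbC -val_eqE /= eq_sym -ltn_neqAle.
Qed.

Lemma sum_sqrt_sbm_pmf (R : rcfType) (n : nat) (p q : R)
    (theta eta : assignment n) : 0 <= p <= 1 -> 0 <= q <= 1 ->
  \sum_(x : graph n) Num.sqrt (sbm_pmf p q theta x * sbm_pmf p q eta x)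
  = affinity p q ^+ #|flipped theta eta|.
Proof.
move=> p01 q01.
pose b (t : assignment n) (e : edge n) (x : bool) :=
  edge_prob p q t e ^+ x * (1 - edge_prob p q t e) ^+ (1 - x).
have b0 t e x : 0 <= b t e x by apply/bernoulli_ge0/edge_prob01.
transitivity (\sum_(x : graph n)
    \prod_(e : edge n) Num.sqrt (b theta e (x e) * b eta e (x e))).
  apply: eq_bigr => x _; rewrite -sqrtr_prod => [|e].
    by rewrite big_split.
  by rewrite mulr_ge0.
rewrite -(bigA_distr_bigA (fun (e : edge n) (x : bool) =>
  Num.sqrt (b theta e x * b eta e x))).
rewrite -prodr_const [RHS]big_mkcond /=; apply: eq_bigr => e _.
rewrite big_bool /b /= !(subnn, subn0, expr1, expr0) !mulr1 !mul1r.
rewrite -/(affinity _ _) inE /edge_prob.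
by case: (_ == _); case: (_ == _) => //=; rewrite ?affinityxx// affinityC.
Qed.

(** * Posterior mass outside a set *)

(** Each wrong assignment gets an expected posterior mass of at most its affinity
    with the true one, because the normalising sum is at least the geometric mean
    of the two likelihoods. *)
Lemma posterior_miss_le (R : rcfType) (n : nat) (p q : R)
    (theta : assignment n) (A : {set assignment n}) :
  0 <= p <= 1 -> 0 <= q <= 1 -> theta \in Theta n -> A \subset Theta n ->
  1 - \sum_(eta in Theta n :\: A) affinity p q ^+ #|flipped theta eta|
  <= sbm_expectation p q theta (posterior p q A) <= 1.
Proof.
move=> p01 q01 thT /finset.setIidPr AT.
have P0 t x : 0 <= sbm_pmf p q t x by exact: sbm_pmf_ge0.
pose D x := \sum_(t in Theta n) sbm_pmf p q t x.
have D0 x : 0 <= D x by exact: sumr_ge0.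
have leD t x : t \in Theta n -> sbm_pmf p q t x <= D x.
  by move=> tT; rewrite /D (bigD1 t)//= lerDl sumr_ge0.
have DS x : D x = \sum_(t in A) sbm_pmf p q t x
    + \sum_(t in Theta n :\: A) sbm_pmf p q t x.
  by rewrite /D (big_setID A) /= AT.
apply/andP; split; last first.
  rewrite -[leRHS](sum_sbm_pmf R n p q theta); apply: ler_sum => x _.
  rewrite ler_piMr// /posterior -/(D x).
  have := D0 x; rewrite le_eqVlt => /predU1P[<-|Dx]; first by rewrite invr0 mulr0.
  by rewrite ler_pdivrMr// mul1r DS lerDl sumr_ge0.
under eq_bigr => eta _ do rewrite -(sum_sqrt_sbm_pmf R n p q)//.
rewrite exchange_big /= -[X in X - _](sum_sbm_pmf R n p q theta) -sumrB.
apply: ler_sum => x _; rewrite /posterior -/(D x).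
(* Where the denominator vanishes, so does the true likelihood. *)
have := D0 x; rewrite le_eqVlt => /predU1P[Dx|Dx].
  have -> : sbm_pmf p q theta x = 0.
    by apply/le_anti; rewrite P0 andbT Dx leD.
  by rewrite mul0r sub0r oppr_le0 sumr_ge0// => t _; exact: sqrtr_ge0.
rewrite lerBlDl -lerBlDr.
have -> : sbm_pmf p q theta x -
    sbm_pmf p q theta x * ((\sum_(t in A) sbm_pmf p q t x) / D x)
  = \sum_(t in Theta n :\: A) sbm_pmf p q theta x * sbm_pmf p q t x / D x.
  rewrite -mulr_suml -mulr_sumr.
  have -> : \sum_(t in Theta n :\: A) sbm_pmf p q t x
     = D x - \sum_(t in A) sbm_pmf p q t x by rewrite DS addrAC subrr add0r.
  by field; rewrite gt_eqF.
apply: ler_sum => t /finset.setDP[tT _].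
rewrite ler_pdivrMr//.
set m := _ * _; have m0 : 0 <= m by rewrite mulr_ge0.
rewrite -[leLHS](sqr_sqrtr m0) expr2 ler_wpM2l ?sqrtr_ge0//.
rewrite -[leRHS](ger0_norm (D0 x)) -sqrtr_sqr ler_wsqrtr// expr2.
by rewrite ler_pM ?leD.
Qed.

(** * Summation over the hypercube *)

(** Choosing [eta] amounts to choosing, for each vertex, whether it is relabelled
    (weight [y]) or kept (weight [z]): this expands [(y + z)^n]. *)
Lemma sum_exp_hdist (R : comNzRingType) (n : nat) (theta : assignment n)
    (y z : R) :
  \sum_(eta : assignment n) y ^+ hdist theta eta * z ^+ (n - hdist theta eta)
  = (y + z) ^+ n.
Proof.
transitivity (\sum_(eta : assignment n) \prod_(i < n)
    (if theta i != eta i then y else z)).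
  apply: eq_bigr => eta _.
  pose M := [set i | theta i != eta i].
  have hE : hdist theta eta = #|M|.
    rewrite -sum1_card [RHS]big_mkcond; apply: eq_bigr => i _.
    by rewrite /M inE; case: eqP.
  rewrite hE (bigID (mem M)) /=; congr (_ * _).
    by rewrite -prodr_const; apply: eq_bigr => i; rewrite inE => ->.
  have -> : (n - #|M|)%N = #|~: M|.
    by rewrite [RHS]finset.cardsCs finset.setCK card_ord.
  rewrite -prodr_const; apply: eq_big => i; first by rewrite inE.
  by rewrite /M !inE => /negbTE ->.
rewrite -(bigA_distr_bigA (fun (i : 'I_n) (b : bool) =>
  if theta i != b then y else z)).
rewrite -[n in RHS]card_ord -prodr_const; apply: eq_bigr => i _.
by rewrite big_bool; case: (theta i) => //=; rewrite addrC.
Qed.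

(** With [h] the Hamming distance, each term is one of the two weights [y^h] and
    [y^(n - h)], and each of these sums to [(1 + y)^n]. *)
Lemma sum_exp_kdist_le (R : realFieldType) (n : nat) (theta : assignment n)
    (y : R) :
  0 <= y -> \sum_(eta : assignment n) y ^+ kdist eta theta <= 2 * (1 + y) ^+ n.
Proof.
move=> y0; rewrite mulr_natl mulr2n.
rewrite -{1}(sum_exp_hdist R n theta 1 y) [1 + y]addrC.
rewrite -(sum_exp_hdist R n theta y 1).
rewrite -big_split /=; apply: ler_sum => eta _.
rewrite !expr1n mulr1 mul1r.
by rewrite kdistE; case: leqP => _; rewrite ?lerDl ?lerDr exprn_ge0.
Qed.

(** The larger of [h] and [n - h] is at least [n / 2], hence the constant 4: one
    factor 2 from it and one from the affinity of an edge. *)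
Lemma affinity_exp_le (R : realType) (n h : nat) (p q : R) :
  0 <= p <= 1 -> 0 <= q <= 1 -> (h <= n)%N ->
  affinity p q ^+ (h * (n - h))
  <= expR (- (n%:R * (Num.sqrt p - Num.sqrt q) ^+ 2 / 4
             * (minn h (n - h))%:R)).
Proof.
move=> p01 q01 hn.
apply: (le_trans (lerXn2r _ _ _ (affinity_le_expR R p q p01 q01))).
- by rewrite nnegrE affinity_ge0.
- by rewrite nnegrE expR_ge0.
rewrite -expRM_natl ler_expR mulrN lerN2.
have : (n * minn h (n - h) <= 2 * (h * (n - h)))%N.
  by have [?|?] := leqP h (n - h); nia.
rewrite -(ler_nat R) !natrM.
have := sqr_ge0 (Num.sqrt p - Num.sqrt q).
set s := (_ ^+ 2); set m := _%:R : R; move=> s0 le.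
have := ler_wpM2l s0 le.
by lra.
Qed.

(** A Chernoff bound that avoids counting: the share 1 of [C] pays for the number of
    far assignments, the share [C - 1] gives the exponential decay. *)
Lemma sum_affinity_far_le (R : realType) (n : nat) (p q a C : R)
    (theta : assignment n) :
  0 <= p <= 1 -> 0 <= q <= 1 -> 0 < a < 1 -> 1 <= C ->
  4 * C * (1 - ln a) <= n%:R * (Num.sqrt p - Num.sqrt q) ^+ 2 ->
  \sum_(eta : assignment n | a * n%:R < (kdist eta theta)%:R)
     affinity p q ^+ #|flipped theta eta|
  <= 2 * expR (- ((C - 1) * (1 - ln a) * a)) ^+ n.
Proof.
move=> p01 q01 /andP[a0 a1] C1 sep.
have lna : ln a <= 0 by rewrite ln_le0// ltW.
set kappa := (C - 1) * (1 - ln a) * a.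
apply: (@le_trans _ _ (\sum_(eta : assignment n)
    expR (- (kappa + a) * n%:R) * a ^+ kdist eta theta)).
  (* C L k = ((C - 1) L + 1) k - k * ln a for L = 1 - ln a; the first summand
     is at least its value at k = a n. *)
  rewrite big_mkcond; apply: ler_sum => eta _.
  case: ifPn => [far|_]; last by rewrite mulr_ge0 ?expR_ge0 ?exprn_ge0 ?ltW.
  rewrite card_flipped.
  apply: le_trans (affinity_exp_le R _ _ p q p01 q01 (hdist_le _ _ _)) _.
  have -> : a ^+ kdist eta theta = expR (ln a * (kdist eta theta)%:R).
    by rewrite expRM_natr lnK.
  rewrite -kdistE -expRD ler_expR.
  move: far sep; set m := (kdist _ _)%:R; set s := _ * _ ^+ 2 => far sep.
  have m0 : 0 <= m by [].
  have sep' := ler_wpM2r m0 sep.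
  have far' : (C - 1) * (1 - ln a) * (a * n%:R) <= (C - 1) * (1 - ln a) * m.
    by apply: ler_wpM2l; [apply: mulr_ge0; lra|exact: ltW].
  by rewrite /kappa; lra.
rewrite -mulr_sumr.
apply: (le_trans (ler_wpM2l (expR_ge0 _)
  (sum_exp_kdist_le R n theta a (ltW a0)))).
(* What remains is (1 + a) exp (- a) <= 1, raised to the power n. *)
rewrite mulrCA ler_wpM2l// expRM_natr -exprMn lerXn2r ?nnegrE ?expR_ge0//.
  by rewrite mulr_ge0 ?expR_ge0 ?addr_ge0 ?ltW.
have -> : - kappa = - (kappa + a) + a by ring.
by rewrite [leRHS]expRD ler_wpM2l ?expR_ge0 ?expR_ge1Dx.
Qed.

(** * Almost exact recovery *)

Local Open Scope classical_set_scope.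

Theorem corollary4p6 (R : realType) (c d : nat -> R)
    (c_ge0 : forall n : nat, (0 < n)%N -> 0 <= c n)
    (d_ge0 : forall n : nat, (0 < n)%N -> 0 <= d n)
    (c_olog : c =o_\oo (fun n : nat => ln (n%:R : R)))
    (d_olog : d =o_\oo (fun n : nat => ln (n%:R : R)))
    (p q : nat -> R)
    (p_def : forall n : nat, (0 < n)%N -> p n = c n / n%:R)
    (q_def : forall n : nat, (0 < n)%N -> q n = d n / n%:R)
    (p01 : forall n : nat, (0 < n)%N -> 0 <= p n <= 1)
    (q01 : forall n : nat, (0 < n)%N -> 0 <= q n <= 1)
    (theta : forall n : nat, assignment n)
    (theta_in : forall n : nat, (0 < n)%N -> theta n \in Theta n)
    (a : R) (a_bounds : 0 < a < 1 / 2)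
    (separation : exists2 C : R, 1 < C &
      \forall n \near \oo,
        (Num.sqrt (c n) - Num.sqrt (d n)) ^+ 2 > 4 * C * (1 - ln a)) :
  sbm_expectation (p n) (q n) (theta n)
    (fun x => posterior (p n) (q n) (kball (theta n) (a * n%:R)) x)
    @[n --> \oo] --> (1 : R).
Proof.
have [C C1 sep] := separation; have /andP[a0 a_half] := a_bounds.
have a1 : a < 1 by lra.
set r := expR (- ((C - 1) * (1 - ln a) * a)).
have r01 : `|r| < 1.
  rewrite ger0_norm ?expR_ge0// expR_lt1 oppr_lt0 !mulr_gt0 ?subr_gt0//.
  by apply: lt_trans ltr01; rewrite ln_lt0 ?a0.
apply: (@squeeze_cvgr _ _ _ _ (fun n => 1 - 2 * r ^+ n) (fun=> 1)); last 2 first.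
- rewrite -[X in _ --> X]subr0; apply: cvgB; first exact: cvg_cst.
  by rewrite -(mulr0 2); apply: cvgM; [exact: cvg_cst|exact: cvg_expr].
- exact: cvg_cst.
near=> n.
have n0 : (0 < n)%N by near: n; exact: nbhs_infty_gt.
have sepn : 4 * C * (1 - ln a) < (Num.sqrt (c n) - Num.sqrt (d n)) ^+ 2.
  by near: n.
have BT : kball (theta n) (a * n%:R) \subset Theta n.
  by apply/fintype.subsetP => eta; rewrite inE => /andP[].
have /andP[lo ->] := posterior_miss_le R n (p n) (q n) (theta n) _
  (p01 n n0) (q01 n n0) (theta_in n n0) BT.
rewrite andbT; apply: le_trans lo; rewrite lerD2l lerN2.
have sep' : 4 * C * (1 - ln a)
    <= n%:R * (Num.sqrt (p n) - Num.sqrt (q n)) ^+ 2.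
  rewrite p_def// q_def// !sqrtrM ?c_ge0 ?d_ge0// -mulrBl exprMn.
  by rewrite sqr_sqrtr ?invr_ge0// mulrCA divff ?mulr1 ?ltW// pnatr_eq0 -lt0n.
have a01 : 0 < a < 1 by rewrite a0.
apply: le_trans (sum_affinity_far_le R n (p n) (q n) a C (theta n)
  (p01 n n0) (q01 n n0) a01 (ltW C1) sep').
rewrite [leLHS]big_mkcond [leRHS]big_mkcond; apply: ler_sum => eta _ /=.
rewrite !inE; case: (eta \in Theta n) => /=; last first.
  by case: ifP => // _; rewrite exprn_ge0 ?affinity_ge0.
by rewrite andbT -ltNge.
Unshelve. all: by end_near. Qed.
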